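(* Let $\tilde T_g\in\mathcal S(X,\mathbb R,C^\alpha_P)$. There exists a uniformly bounded function $u:X\setminus R_P\to\mathbb R$ such that $u(Tx)=g_x(u(x))$ for all $x\in X\setminus R_P$. Any other uniformly bounded function $v:X\setminus R_P\to\mathbb R$ satisfying $v(Tx)=g_x(v(x))$ for all $x\in X\setminus R_P$ is equal to $u$. Moreover, if $\mu$ is an ergodic ($T$-invariant Borel probability) measure for $T$ that is not supported on $R_P$, then $u$ is $\mu$-a.e. unique amongst measurable functions: any measurable $v$ with $v(Tx)=g_x(v(x))$ for $\mu$-a.e. $x$ satisfies $v=u$ $\mu$-a.e.
   Context: **Base map.** $X=\mathbb R/\mathbb Z$ is the circle with its usual metric $d$, viewed as $[0,1]$ with $0$ and $1$ identified. $T:X\to X$ is a continuous, expanding, locally eventually onto Markov map: $T$ is continuous; there are $0=t_0<t_1<\dots<t_b=1$ and $X_j=[t_j,t_{j+1}]$ such that for each $j$ the restriction of $T$ to $\mathrm{Int}\,X_j$ is a $C^1$ diffeomorphism onto its image, with derivative extending continuously to the end-points, and $T(X_j)=\bigcup_{i\in I_j}X_i$ is a union of partition intervals; there is $\theta\in(0,1)$ with $|T'(x)|\ge\theta^{-1}$ for all $x\in\bigcup_j\mathrm{Int}\,X_j$; and there is $N\in\mathbb N$ with $T^NX_j=X$ for all $j$. **Skew product.** $\tilde T_g(x,t)=(Tx,g_x(t))$ on $X\times\mathbb R$, where $g_x:\mathbb R\to\mathbb R$ is a homeomorphism for each $x\in X$. Write $h_x=g_x^{-1}$, $g^n_x=g_{T^{n-1}x}\circ\dots\circ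 g_{Tx}\circ g_x$ and $h^n_x=(g^n_x)^{-1}=h_x\circ h_{Tx}\circ\dots\circ h_{T^{n-1}x}$. $P=\bigcup_{r=0}^{\rho-1}P_r\subset X$ is a finite union of $\rho$ distinct periodic orbits of $T$; $\ell(p)$ is the least period of $p\in P$; $B_\delta(P)=\bigcup_{p\in P}B_\delta(p)$ with $B_\delta(p)$ the open ball of radius $\delta$. $R_P=\{x\in X: T^nx\in P\text{ for some }n\ge0\}$. **The class $\mathcal S(X,\mathbb R,C^\alpha_P)$.** Fix $\alpha>0$ and $C_{\mathcal S}\ge1$. $\tilde T_g\in\mathcal S(X,\mathbb R,C^\alpha_P)$ (one also writes $g\in C^\alpha_P$) means that the following hold for some small $\epsilon>0$: (i) $g_p^{\ell(p)}(t)=t$ for all $p\in P$, $t\in\mathbb R$; (ii) $|h^n_x(t)-h^n_x(t')|\le C_{\mathcal S}|t-t'|$ for all $x\in X$, $n\in\mathbb N$, $t,t'\in\mathbb R$; (iii) there is $\lambda:[0,\epsilon]\to(0,\infty)$ with $\log\lambda$ Hölder continuous (some positive exponent) and $\lambda(0)=1$ such that, whenever $x,\dots,T^{n-1}x\in B_\epsilon(P)$ and $\epsilon_j=\inf_{p\in P}d(T^jx,p)$, $|h^n_x(t)-h^n_x(t')|\ge C_{\mathcal S}^{-1}\lambda(\epsilon_0)\cdots\lambda(\epsilon_{n-1})|t-t'|$ for all $t,t'$; (iv) for each $0<\delta\le\epsilon$ there is $\lambda_\delta\in(0,1)$ such that, whenever the orbit segment $x,\dots,T^{n-1}x$ visits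 $X\setminus B_\delta(P)$ exactly $j$ times, $|h^n_x(t)-h^n_x(t')|\le C_{\mathcal S}\lambda_\delta^j|t-t'|$ for all $t,t'$; (v) $|g_x(t)-g_y(t)|\le C_g(t)d(x,y)^\alpha$ and $|h_x(t)-h_y(t)|\le C_h(t)d(x,y)^\alpha$ for all $x,y\in X$, $t\in\mathbb R$, with $C_g,C_h$ bounded on compact subsets of $\mathbb R$. *)

(* Defs.v *)
From HB Require Import structures.
From mathcomp Require Import all_boot all_order all_algebra.
From mathcomp Require Import ring lra.
From mathcomp Require Import all_classical all_reals all_analysis.

Set Implicit Arguments.
Unset Strict Implicit.
Unset Printing Implicit Defensive.

Import Order.TTheory GRing.Theory Num.Theory.
Import numFieldNormedType.Exports.

Local Open Scope classical_set_scope.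
Local Open Scope ring_scope.

(** The circle R/Z, carried by the fundamental domain [0, 1[ and equipped with
    the quotient metric.  The projection from the line is [to_circle]
    (fractional part), whose fibres are the cosets of Z (lemma [to_circleP]). *)

Record circle (R : realType) := Circle {
  circle_val : R;
  _ : 0 <= circle_val < 1 }.

HB.instance Definition _ (R : realType) := [isSub for @circle_val R].
HB.instance Definition _ (R : realType) := [Choice of circle R by <:].

Section CircleStructure.
Context {R : realType}.
Implicit Types x y z : circle R.

Lemma circle_val_itv x : 0 <= circle_val x < 1.
Proof. by case: x. Qed.

Definition circle_dist x y : R :=
  Num.min `|circle_val x - circle_val y| (1 - `|circle_val x - circle_val y|).

Lemma circle_dist_xx x : circle_dist x x = 0.
Proof. by rewrite /circle_dist subrr normr0 subr0; apply/min_idPl; rewrite ler01. Qed.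

Lemma circle_dist_positivity x y : circle_dist x y = 0 -> x = y.
Proof.
have := circle_val_itv x; have := circle_val_itv y.
rewrite /circle_dist => /andP[y0 y1] /andP[x0 x1].
case: leP => _ d0; apply: val_inj => /=.
  by apply/eqP; rewrite -subr_eq0 -normr_eq0 d0.
exfalso; move: d0; case: (ger0P (circle_val x - circle_val y)) => ?; lra.
Qed.

Lemma circle_dist_sym x y : circle_dist x y = circle_dist y x.
Proof. by rewrite /circle_dist distrC. Qed.

Lemma circle_dist_triangle y x z :
  circle_dist x z <= circle_dist x y + circle_dist y z.
Proof.
have /andP[x0 x1] := circle_val_itv x.
have /andP[y0 y1] := circle_val_itv y.
have /andP[z0 z1] := circle_val_itv z.
rewrite /circle_dist; move: (circle_val x) (circle_val y) (circle_val z)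
  x0 x1 y0 y1 z0 z1 => a b c a0 a1 b0 b1 c0 c1.
case: (ger0P (a - c)) => ?; case: (ger0P (a - b)) => ?;
  case: (ger0P (b - c)) => ?;
  rewrite !minEle; do 3 (case: ifPn; rewrite -?ltNge => ?); lra.
Qed.

HB.instance Definition _ := isMetric.Build R (circle R)
  circle_dist_xx circle_dist_positivity circle_dist_sym circle_dist_triangle.

Lemma to_circle_subproof (s : R) : 0 <= s - (Num.floor s)%:~R < 1.
Proof.
have := floor_le s; have := floorD1_gt s; rewrite intrD => ? ?.
by apply/andP; split; lra.
Qed.

Definition to_circle (s : R) : circle R := Circle (to_circle_subproof s).

Lemma to_circleP (s t : R) :
  to_circle s = to_circle t <-> exists k : int, s = t + k%:~R.
Proof.
split=> [/(congr1 val)/= st|[k ->]].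
  by exists (Num.floor s - Num.floor t); rewrite intrB; lra.
by apply: val_inj => /=; rewrite floorDrz ?intr_int// intrKfloor intrD; lra.
Qed.

HB.instance Definition _ := isPointed.Build (circle R) (to_circle 0).

HB.instance Definition _ := Measurable.copy (circle R)
  (g_sigma_algebraType (@open (circle R))).

End CircleStructure.

Section BaseMap.
Context {R : realType}.
Implicit Types (f T : circle R -> circle R) (x : circle R) (A O : set (circle R)).

Definition closed_arc (a b : R) : set (circle R) := to_circle @` `[a, b].
Definition open_arc (a b : R) : set (circle R) := to_circle @` `]a, b[.

(** Derivative of a circle map, read in the chart [to_circle]: some local lift
    [F] of [f] has derivative [l].  [F] is differentiable, hence continuous, at
    the base point, so it is determined near it up to an additive integer and
    [l] is unique. *)
Definition is_circle_derive f x (l : R) : Prop :=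
  exists2 F : R -> R,
    \forall s \near circle_val x, f (to_circle s) = to_circle (F s) &
    is_derive (circle_val x) (1 : R) F l.

(** [A] is meant to be open. *)
Definition C1_on f A : Prop :=
  exists2 f' : circle R -> R,
    (forall x, A x -> is_circle_derive f x (f' x)) & {within A, continuous f'}.

Definition C1_diffeo_onto_image f A : Prop :=
  C1_on f A /\
  exists2 k : circle R -> circle R,
    (forall x, A x -> k (f x) = x) & C1_on k (f @` A).

(** The interior of the partition interval [t_j, t_(j+1)] is that of an interval
    of [0, 1], i.e. the open arc: 0 = 1 is always a partition point. *)
Record markov_partition T (b : nat) (t : nat -> R) : Prop := {
  partition_start : t 0%N = 0;
  partition_end : t b = 1;
  partition_lt : forall j, (j < b)%N -> t j < t j.+1;
  branch_diffeo : forall j, (j < b)%N ->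
    C1_diffeo_onto_image T (open_arc (t j) (t j.+1));
  branch_derive_extends : forall j, (j < b)%N ->
    exists2 D : R -> R, {within `[t j, t j.+1], continuous D} &
      forall s, s \in `]t j, t j.+1[ -> is_circle_derive T (to_circle s) (D s);
  branch_image : forall j, (j < b)%N ->
    exists2 I : set nat, I `<=` `I_b &
      T @` closed_arc (t j) (t j.+1) =
      \bigcup_(i in I) closed_arc (t i) (t i.+1) }.

Definition expanding T (b : nat) (t : nat -> R) : Prop :=
  exists2 theta : R, 0 < theta < 1 &
    forall j x l, (j < b)%N -> open_arc (t j) (t j.+1) x ->
      is_circle_derive T x l -> theta^-1 <= `|l|.

Definition locally_eventually_onto T (b : nat) (t : nat -> R) : Prop :=
  exists N : nat, forall j, (j < b)%N ->
    iter N T @` closed_arc (t j) (t j.+1) = setT.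

Definition expanding_markov_map T : Prop :=
  continuous T /\
  exists b t, [/\ markov_partition T b t, expanding T b t
                & locally_eventually_onto T b t].

Definition least_period T x (l : nat) : Prop :=
  [/\ (0 < l)%N, iter l T x = x
    & forall k, (0 < k < l)%N -> iter k T x <> x].

Definition periodic_orbit T O : Prop :=
  exists x l, least_period T x l /\ O = [set iter i T x | i in `I_l].

Definition eventually_in T (P : set (circle R)) : set (circle R) :=
  [set x | exists n, P (iter n T x)].

Definition ball_around (P : set (circle R)) (delta : R) : set (circle R) :=
  \bigcup_(p in P) ball p delta.

Definition dist_to (P : set (circle R)) x : R := inf [set mdist x p | p in P].

Definition invariant_measure T (mu : probability (circle R) R) : Prop :=
  forall A, measurable A -> mu (T @^-1` A) = mu A.

Definition ergodic_measure T (mu : probability (circle R) R) : Prop :=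
  invariant_measure T mu /\
  forall A, measurable A -> T @^-1` A = A -> mu A = 0%E \/ mu A = 1%E.

End BaseMap.

Section SkewProduct.
Context {R : realType}.
Implicit Types (T : circle R -> circle R) (x y p : circle R).
Implicit Types (P : set (circle R)) (g h : circle R -> R -> R).

Definition fibre_homeomorphisms g h : Prop :=
  forall x, [/\ cancel (g x) (h x), cancel (h x) (g x),
                continuous (g x) & continuous (h x)].

(** g^n_x = g_(T^(n-1) x) \o ... \o g_(T x) \o g_x *)
Fixpoint fibre_iter T g (n : nat) x (t : R) : R :=
  if n is m.+1 then g (iter m T x) (fibre_iter T g m x t) else t.

(** h^n_x = h_x \o h_(T x) \o ... \o h_(T^(n-1) x) *)
Fixpoint fibre_iter_inv T h (n : nat) x (t : R) : R :=
  if n is m.+1 then fibre_iter_inv T h m x (h (iter m T x) t) else t.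

Lemma fibre_iterK T g h (n : nat) x : fibre_homeomorphisms g h ->
  cancel (fibre_iter T g n x) (fibre_iter_inv T h n x) /\
  cancel (fibre_iter_inv T h n x) (fibre_iter T g n x).
Proof.
move=> gh; elim: n => [|n [IHl IHr]]; first by split.
by have [gK hK _ _] := gh (iter n T x); split=> t /=; rewrite ?gK ?IHl ?IHr ?hK.
Qed.

Definition holder_on (D : set R) (f : R -> R) : Prop :=
  exists beta K : R, 0 < beta /\
    forall s t, D s -> D t -> `|f s - f t| <= K * `|s - t| `^ beta.

Definition bounded_on_compacts (f : R -> R) : Prop :=
  forall K : set R, compact K -> [bounded f t | t in K].

Definition visits T (A : set (circle R)) (n : nat) x : nat :=
  \sum_(i < n) (iter i T x \in A).

(** The class S(X, R, C^alpha_P) with constant [CS].  [h x] is the inverse of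
    [g x], see [fibre_homeomorphisms].  When [P] is empty the value of [dist_to]
    is a dummy but is never used, since no orbit then meets [ball_around]. *)
Definition skew_class T P (alpha CS : R) g h : Prop :=
  exists2 eps : R, 0 < eps &
  [/\ forall p l t, P p -> least_period T p l -> fibre_iter T g l p t = t,
      forall x n t t', `|fibre_iter_inv T h n x t - fibre_iter_inv T h n x t'|
        <= CS * `|t - t'|,
      exists lambda : R -> R,
        [/\ forall s, s \in `[0, eps] -> 0 < lambda s,
            holder_on `[0, eps] (fun s => ln (lambda s)),
            lambda 0 = 1
          & forall x n,
              (forall i, (i < n)%N -> ball_around P eps (iter i T x)) ->
              forall t t',
                CS^-1 * (\prod_(i < n) lambda (dist_to P (iter i T x)))
                  * `|t - t'|
                <= `|fibre_iter_inv T h n x t - fibre_iter_inv T h n x t'|],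
      forall delta, 0 < delta <= eps ->
        exists2 lambda_delta : R, 0 < lambda_delta < 1 &
          forall x n t t',
            `|fibre_iter_inv T h n x t - fibre_iter_inv T h n x t'|
            <= CS * lambda_delta ^+ visits T (~` ball_around P delta) n x
               * `|t - t'|
    & exists Cg Ch : R -> R,
        [/\ bounded_on_compacts Cg, bounded_on_compacts Ch
          & forall x y t,
              `|g x t - g y t| <= Cg t * mdist x y `^ alpha /\
              `|h x t - h y t| <= Ch t * mdist x y `^ alpha]].

End SkewProduct.

(* Main.v *)
(** The graph is the pull-back limit u x = lim h^n_x 0.  A point that stays near
    the periodic set P shadows an orbit of P with exponentially decreasing error,
    because T expands; since the fibre maps over P are periodic, telescoping the
    alpha-Hoelder bound on h along the two orbits bounds h^m_y 0 as long as y
    stays near P.  Each visit away from P contracts by a factor lambda < 1, so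
    that the corrections made between consecutive visits sum to a geometric
    series and h^n_x 0 is bounded uniformly in x and n.  A point outside R_P
    visits the complement of a neighbourhood of P infinitely often, by expansion
    again, whence convergence and uniqueness along any orbit on which the
    solution is bounded infinitely often.  The latter holds mu-almost everywhere
    by Poincare recurrence. *)
Require Import Defs.
From mathcomp Require Import all_boot all_order all_algebra.
From mathcomp Require Import all_classical all_reals all_analysis.
From mathcomp Require Import measurable_realfun ring lra zify.
Import Order.TTheory GRing.Theory Num.Theory.
Import numFieldNormedType.Exports.
Set Implicit Arguments.
Unset Strict Implicit.
Unset Printing Implicit Defensive.
Local Open Scope classical_set_scope.
Local Open Scope ring_scope.

(** * The circle as a quotient of the line: distances and lifts *)

Lemma to_circle_val (R : realType) (x : circle R) : to_circle (circle_val x) = x.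
Proof.
have /andP[x0 x1] := circle_val_itv x.
apply: val_inj => /=; suff -> : Num.floor (circle_val x) = 0 by rewrite subr0.
by apply: floor_def; rewrite x0 add0r x1.
Qed.

Lemma int_trichotomy (R : realType) (m : int) :
  [\/ m = 0, (1 : R) <= m%:~R | m%:~R <= (-1 : R)].
Proof.
have [m0|m0|->] := ltgtP m 0; last by constructor 1.
- constructor 3; have : m <= -1 by lia.
  by rewrite -(ler_int R) rmorphN1.
- by constructor 2; rewrite ler1z.
Qed.

(** The representatives in [0, 1[ differ by r - r' minus an integer. If that integer is 0 the first
    term of the minimum gives the bound; otherwise it has absolute value at least 1 and the second
    term does. *)
Lemma mdist_to_circle_le (R : realType) (r r' : R) :
  mdist (to_circle r) (to_circle r') <= `|r - r'|.
Proof.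
have /andP[x0 x1] := circle_val_itv (to_circle r).
have /andP[y0 y1] := circle_val_itv (to_circle r').
rewrite /mdist/= /circle_dist ge_min; apply/orP; move: x0 x1 y0 y1 => /=.
set k := Num.floor r; set k' := Num.floor r' => x0 x1 y0 y1.
have [e|e|e] := int_trichotomy R (k - k').
- left; suff -> : r - k%:~R - (r' - k'%:~R) = r - r' by [].
  have -> : k = k' by lia.
  lra.
- right; rewrite intrB in e.
  by case: (ger0P (r - r')) => ?; case: (ger0P (r - k%:~R - _)) => ?; lra.
- right; rewrite intrB in e.
  by case: (ger0P (r - r')) => ?; case: (ger0P (r - k%:~R - _)) => ?; lra.
Qed.

(** Up to half the length of the circle the two floors differ by at most 1, and then both terms of
    the minimum are at least the distance on the line. *)
Lemma mdist_to_circle (R : realType) (r r' : R) : `|r - r'| <= 2^-1 ->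
  mdist (to_circle r) (to_circle r') = `|r - r'|.
Proof.
move=> rr'; apply/eqP; rewrite eq_le mdist_to_circle_le/=.
have /andP[x0 x1] := circle_val_itv (to_circle r).
have /andP[y0 y1] := circle_val_itv (to_circle r').
rewrite /mdist/= /circle_dist le_min; move: x0 x1 y0 y1 => /=.
set k := Num.floor r; set k' := Num.floor r' => x0 x1 y0 y1.
have [e|e|e] := int_trichotomy R (k - k').
- have -> : r - k%:~R - (r' - k'%:~R) = r - r'.
    have -> : k = k' by lia.
    lra.
  by rewrite lexx/=; lra.
- have h : k - k' <= 1.
    rewrite -ltzD1 -(ltr_int R) !rmorphD !rmorphN/= ?rmorph1.
    by move: rr'; rewrite ler_norml => /andP[? ?]; lra.
  rewrite -(ler_int R) !rmorphD !rmorphN/= ?rmorph1 in h.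
  rewrite intrB in e; move: rr'.
  by case: (ger0P (r - r')) => ? ?; case: (ger0P (r - k%:~R - _)) => ?;
    apply/andP; split; lra.
- have h : -1 <= k - k'.
    rewrite -ltzD1 -(ltr_int R) !rmorphD !rmorphN/= ?rmorph1.
    by move: rr'; rewrite ler_norml => /andP[? ?]; lra.
  rewrite -(ler_int R) !rmorphD !rmorphN/= ?rmorph1 in h.
  rewrite intrB in e; move: rr'.
  by case: (ger0P (r - r')) => ? ?; case: (ger0P (r - k%:~R - _)) => ?;
    apply/andP; split; lra.
Qed.

Lemma continuous_to_circle (R : realType) : continuous (@to_circle R).
Proof.
move=> r; apply/metricType_numDomainType.cvgrPdist_lt => e e0.
apply/nbhs_ballP; exists e => //= s rs.
exact: le_lt_trans (mdist_to_circle_le _ _) rs.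
Qed.

(** The difference of the representatives serves, corrected by 1 or -1 when it exceeds one half.
    This provides lifts of circle maps whose size is a distance. *)
Lemma centered_lift (R : realType) (q y : circle R) :
  exists s, to_circle (circle_val q + s) = y /\ `|s| = mdist q y.
Proof.
have /andP[x0 x1] := circle_val_itv q; have /andP[y0 y1] := circle_val_itv y.
suff [s [ys s2]] : exists s, to_circle (circle_val q + s) = y /\ `|s| <= 2^-1.
  exists s; split => //; rewrite -ys -{1}(to_circle_val q) mdist_to_circle.
    by rewrite -normrN; congr (`| _ |); ring.
  by rewrite -normrN; move: s2; congr (`| _ | <= _); ring.
have [|h] := lerP `|circle_val y - circle_val q| 2^-1.
  by exists (circle_val y - circle_val q); rewrite addrC subrK to_circle_val.
case: (ger0P (circle_val y - circle_val q)) h => [? h|? h].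
  exists (circle_val y - circle_val q - 1); split.
    rewrite -[RHS]to_circle_val; apply/to_circleP; exists (-1).
    by rewrite rmorphN1; ring.
  by rewrite ler_norml; apply/andP; split; lra.
exists (circle_val y - circle_val q + 1); split.
  by rewrite -[RHS]to_circle_val; apply/to_circleP; exists 1; rewrite rmorph1; ring.
by rewrite ler_norml; apply/andP; split; lra.
Qed.

(** * Lifts of the base map and local expansion *)

Lemma nbhs_mdist_lt (R : realType) (p : circle R) (e : R) : 0 < e ->
  \forall x \near p, mdist p x < e.
Proof. by move=> e0; apply/nbhs_ballP; exists e. Qed.

(** The difference of two lifts is continuous and integer-valued near [s], hence locally
    constant. *)
Lemma lift_near_cst (R : realType) (F G : R -> R) (s : R) :
  {for s, continuous F} -> {for s, continuous G} ->
  (\forall r \near s, to_circle (F r) = to_circle (G r)) ->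
  \forall r \near s, F r = G r + (F s - G s).
Proof.
move=> cF cG FG.
have cD : {for s, continuous (fun r => F r - G r)} by exact: continuousB.
have H : \forall r \near s, `|F s - G s - (F r - G r)| < 1.
  by move/cvgrPdist_lt : cD; apply.
have [k0 k0E] := iffLR (to_circleP _ _) (nbhs_singleton FG).
near=> r.
have : to_circle (F r) = to_circle (G r) by near: r.
have : `|F s - G s - (F r - G r)| < 1 by near: r.
move=> + /to_circleP[k kE]; rewrite k0E kE => h.
suff -> : k = k0 by ring.
have {}h : `|(k0 - k)%:~R : R| < 1.
  by rewrite intrB; move: h; congr (`| _ | < _); ring.
have := @int_trichotomy R (k0 - k) => -[|e|e]; first lia.
  by move: h; rewrite ltr_norml => /andP[_]; rewrite ltNge e.
by move: h; rewrite ltr_norml => /andP[]; rewrite ltNge e.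
Unshelve. all: by end_near. Qed.

(** The mean value theorem is applied to a lift [F] of [T] centred at [p], on the segment from 0 to
    [s]. The derivative at [p] itself is not assumed, since [p] may be a partition point. *)
Lemma local_expansion (R : realType) (T : circle R -> circle R) (theta : R) p :
  continuous T -> 0 < theta ->
  (\forall x \near p, x != p ->
     exists2 l, is_circle_derive T x l & theta^-1 <= `|l|) ->
  \forall x \near p, mdist p x <= theta * mdist (T p) (T x).
Proof.
move=> cT theta0 Tp.
set a := circle_val p; set b := circle_val (T p).
pose f s := T (to_circle (a + s)).
have cf : continuous f.
  move=> s; apply: continuous_comp; last exact: cT.
  apply: continuous_comp; last exact: continuous_to_circle.
  by apply: continuousD => //; exact: cst_continuous.
have [F HF] := choice (fun s => centered_lift (T p) (f s)).
have f0 : f 0 = T p by rewrite /f addr0 to_circle_val.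
have F0 : F 0 = 0.
  by apply/eqP; rewrite -normr_eq0 (HF 0).2 f0 mdistxx.
(* Values of [F] below 1/4 have differences below 1/2, where [to_circle] is isometric; [s] below 1/4
   and nonzero keeps [to_circle (a + s)] different from [p]. *)
have [e /andP[e0 e2] He] : exists2 e : R, 0 < e < 2^-1 & forall s, `|s| < e ->
    `|F s| < 4^-1 /\ (s != 0 -> exists2 l, is_circle_derive T (to_circle (a + s)) l
      & theta^-1 <= `|l|).
  have h1 : \forall s \near (0:R), mdist (T p) (f s) < 4^-1.
    have /metricType_numDomainType.cvgrPdist_lt := cf 0.
    by rewrite f0; apply; rewrite invr_gt0.
  have h2 : \forall s \near (0:R), to_circle (a + s) != p ->
      exists2 l, is_circle_derive T (to_circle (a + s)) l & theta^-1 <= `|l|.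
    have : to_circle (a + s) @[s --> (0:R)] --> p.
      rewrite -[X in _ --> X]to_circle_val -[circle_val p]addr0.
      apply: (@continuous_comp _ _ _ (fun s => a + s) (@to_circle R)).
        by apply: continuousD => //; exact: cst_continuous.
      exact: continuous_to_circle.
    by move=> /(_ _ Tp).
  have h3 := @filterI _ (nbhs (0 : R)) (nbhs_filter _) _ _ h1 h2.
  have [d /= d0 hd] := iffLR (nbhs_ballP _ _) h3.
  exists (Num.min d 4^-1).
    rewrite lt_min d0 invr_gt0 ltr0n/= gt_min; apply/orP; right.
    by rewrite ltf_pV2 ?posrE// ltr_nat.
  move=> s; rewrite lt_min => /andP[sd s4].
  have [|H1 H2] := hd s; first by rewrite /ball/= sub0r normrN.
  split; first by rewrite (HF s).2.
  move=> s0; apply: H2; apply/eqP => E.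
  have : mdist (to_circle (a + s)) (to_circle a) = `|s|.
    rewrite mdist_to_circle addrAC subrr add0r// ltW// (lt_trans s4)//.
    by rewrite ltf_pV2 ?posrE// ltr_nat.
  by rewrite E to_circle_val mdistxx => /esym/eqP; rewrite normr_eq0 (negbTE s0).
have distF s s' : `|s| < e -> `|s'| < e -> mdist (f s) (f s') = `|F s - F s'|.
  move=> /He[Fs _] /He[Fs' _]; rewrite -(HF s).1 -(HF s').1.
  have E : b + F s - (b + F s') = F s - F s' by ring.
  rewrite mdist_to_circle E//.
  move: Fs Fs'; rewrite !ltr_norml ler_norml => /andP[? ?] /andP[? ?].
  by apply/andP; split; lra.
(* [F] comes from a mere choice of lifts; the isometry [distF] makes it continuous. *)
have cF s : `|s| < e -> {for s, continuous F}.
  move=> se; apply/cvgrPdist_lt => eps eps0.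
  have h1 : \forall t \near s, mdist (f s) (f t) < eps.
    by have /metricType_numDomainType.cvgrPdist_lt := cf s; apply.
  have h2 : \forall t \near s, `|t| < e.
    apply/nbhs_ballP; exists (e - `|s|) => [|t]; first by rewrite /= subr_gt0.
    by rewrite /ball/= -{2}(subKr s t); have := ler_normB s (s - t); lra.
  by near=> t; rewrite -distF//; near: t.
(* The derivative of [T] is known through a lift [G] read at [circle_val x], which differs from
   [a + s] by an integer. After this shift [G] and [b + F] lift the same map near [s], so they
   differ by a constant. *)
have dF s : `|s| < e -> s != 0 ->
    exists2 l, is_derive s (1:R) F l & theta^-1 <= `|l|.
  move=> se s0; have [_ /(_ s0)[l [G TG dG] hl]] := He s se.
  exists l => //; set x := to_circle (a + s) in TG dG.
  have /to_circleP[k kE] : to_circle (a + s) = to_circle (circle_val x).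
    by rewrite to_circle_val.
  have xE : circle_val x = s + (a - k%:~R) by rewrite (addrC a) in kE; lra.
  pose G' := G \o shift (a - k%:~R).
  have dG' : is_derive s (1:R) G' l.
    rewrite -[l]mulr1; apply: is_derive1_comp; last exact: is_derive_shift.
    by rewrite /= -xE.
  have cG' : {for s, continuous G'}.
    exact/differentiable_continuous/derivable1_diffP/(@ex_derive _ _ _ _ _ _ _ dG').
  have cbF : {for s, continuous (fun r => b + F r)}.
    by apply: continuousD; [exact: cst_continuous|exact: cF].
  have E : \forall r \near s, to_circle (b + F r) = to_circle (G' r).
    have h : \forall r \near s, T (to_circle (r + (a - k%:~R))) =
        to_circle (G (r + (a - k%:~R))).
      have : shift (a - k%:~R) r @[r --> s] --> circle_val x.
        by rewrite xE; apply: cvgD; [exact: cvg_id|exact: cvg_cst].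
      by move=> /(_ _ TG).
    near=> r; rewrite (HF r).1 /f.
    have <- : T (to_circle (r + (a - k%:~R))) = to_circle (G' r) by near: r.
    congr T; apply/to_circleP; exists k; ring.
  have {}E := lift_near_cst cbF cG' E.
  apply: (@near_eq_is_derive _ _ _ (G' + cst (F s - G' s))).
    near=> r; rewrite fctE /cst/=.
    have : b + F r = G' r + (b + F s - G' s) by near: r.
    by move=> ?; lra.
  by rewrite -[l]addr0; apply: is_deriveD.
have mvt s1 s2 : s1 < s2 -> `|s1| < e -> `|s2| < e -> 0 \notin `]s1, s2[%R ->
    exists2 l, F s2 - F s1 = l * (s2 - s1) & theta^-1 <= `|l|.
  move=> s12 s1e s2e n0.
  have lt_e x : s1 <= x <= s2 -> `|x| < e.
    move: s1e s2e; rewrite !ltr_norml => /andP[? ?] /andP[? ?] /andP[? ?].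
    by apply/andP; split; lra.
  have dFx x : x \in `]s1, s2[%R ->
      exists2 l, is_derive x (1:R) F l & theta^-1 <= `|l|.
    move=> xs; apply: dF; last by apply: contraNneq n0 => <-.
    by apply: lt_e; move: xs; rewrite in_itv/= => /andP[/ltW -> /ltW ->].
  have [x /dFx[l Fl hl]||x xs ->] := @MVT R F (fun x => 'D_1 F x) _ _ s12.
  - by apply: DeriveDef => //; exact: ex_derive.
  - apply: continuous_in_subspaceT => x; rewrite inE/= in_itv/= => xs.
    exact/cF/lt_e.
  - have [l Fl hl] := dFx x xs; exists l => //.
    by rewrite derive_val.
have expF s : `|s| < e -> `|s| <= theta * `|F s|.
  suff : `|s| < e -> exists2 l, F s = l * s & theta^-1 <= `|l|.
    move=> /[apply] -[l -> hl]; rewrite normrM mulrA ler_peMl//.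
    by rewrite -(mulfV (lt0r_neq0 theta0)) ler_pM2l.
  have e0' : `|0 : R| < e by rewrite normr0.
  move=> se; have [s0|s0|->] := ltgtP s 0.
  - have [|l E hl] := mvt _ _ s0 se e0'; first by rewrite in_itv/= ltxx andbF.
    by exists l => //; move: E; rewrite F0; lra.
  - have [|l E hl] := mvt _ _ s0 e0' se; first by rewrite in_itv/= ltxx.
    by exists l => //; move: E; rewrite F0; lra.
  - exists theta^-1; first by rewrite F0 mulr0.
    by rewrite ger0_norm// ltW// invr_gt0.
near=> x.
have xe : mdist p x < e by near: x; exact: nbhs_mdist_lt.
have [s [xE sE]] := centered_lift p x; have se : `|s| < e by rewrite sE.
have E := distF 0 s _ se; rewrite normr0 in E.
by rewrite -xE -/a -/(f s) -f0 E// F0 sub0r normrN /a xE -sE; exact: expF.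
Unshelve. all: by end_near. Qed.

Lemma partition_find (R : realType) (t : nat -> R) (v : R) (b : nat) :
  t 0%N <= v < t b -> exists2 j, (j < b)%N & t j <= v < t j.+1.
Proof.
elim: b => [|b IHb] /andP[v0 vb]; first by rewrite leNgt vb in v0.
have [vlt|vge] := ltP v (t b); last by exists b => //; rewrite vge.
by have [|j jb jv] := IHb; [rewrite v0|exists j => //; exact: ltnW].
Qed.

Lemma finite_set_closed_circle (R : realType) (A : set (circle R)) :
  finite_set A -> closed A.
Proof.
move: A; apply/accessible_finite_set_closed/hausdorff_accessible.
exact: metric_hausdorff.
Qed.

Lemma near_not_in_finite (R : realType) (A : set (circle R)) (p : circle R) :
  finite_set A -> \forall x \near p, x != p -> ~ A x.
Proof.
move=> fA; have : open (~` (A `\ p)).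
  apply: closed_openC; apply: finite_set_closed_circle.
  by apply: sub_finite_set fA; exact: subDsetl.
rewrite openE => /(_ p) h; have h1 : (~` (A `\ p)) p by move=> [_ h1]; exact: h1.
by apply: filterS (h h1) => x Hx /eqP xp Ax; exact: Hx.
Qed.

(** Near [p] no point other than [p] is a partition point, so each lies in an open arc, where the
    derivative is bounded below. *)
Lemma markov_local_expansion (R : realType) (T : circle R -> circle R) :
  expanding_markov_map T -> exists2 theta : R, 0 < theta < 1 &
    forall p, \forall x \near p, mdist p x <= theta * mdist (T p) (T x).
Proof.
move=> [cT [b [t [Tt [theta th Ttheta] _]]]]; exists theta => // p.
case/andP: (th) => th0 _; apply: local_expansion => //.
(* The last point [t b] is left out: it is 1 and projects to the same point as [t 0]. *)
have := @near_not_in_finite _ [set to_circle (t j) | j in `I_b] p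
  (finite_image _ (finite_II b)).
apply: filterS => x /[apply] xt.
have [|j jb /andP[tj tj1]] := @partition_find R t (circle_val x) b.
  by rewrite (partition_start Tt) (partition_end Tt) circle_val_itv.
have xj : open_arc (t j) (t j.+1) x.
  exists (circle_val x); last exact: to_circle_val.
  rewrite /= in_itv/= tj1 andbT lt_neqAle tj andbT.
  by apply/eqP => tjx; apply: xt; exists j => //; rewrite tjx to_circle_val.
have [[f' df' _] _] := branch_diffeo Tt jb.
by exists (f' x); [exact: df'|exact: Ttheta jb xj (df' _ xj)].
Qed.

(** * Shadowing near a finite forward invariant set *)

Lemma finite_set_common_radius (R : realType) (U : choiceType) (A : set U)
    (Q : U -> R -> Prop) : finite_set A ->
  (forall p d d', 0 < d' -> d' <= d -> Q p d -> Q p d') ->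
  (forall p, A p -> exists2 d, 0 < d & Q p d) ->
  exists2 d, 0 < d & forall p, A p -> Q p d.
Proof.
move=> /finite_seqP[s ->] Qle; elim: s => [|p s IHs] AQ.
  by exists 1 => // p; rewrite /= in_nil.
have [|d d0 dP] := IHs.
  by move=> q qs; apply: AQ; rewrite /= in_cons [q \in s]qs orbT.
have [|d' d'0 d'P] := AQ p; first by rewrite /= mem_head.
exists (Num.min d d'); first by rewrite lt_min d0 d'0.
move=> q; rewrite /= in_cons => /orP[/eqP->|qs].
  by apply: Qle d'P; rewrite ?lt_min ?d0 ?d'0// ge_min lexx orbT.
by apply: (Qle _ d); rewrite ?lt_min ?d0 ?d'0// ?ge_min ?lexx//; exact: dP.
Qed.

Lemma continuous_mdist (R : realType) (T : circle R -> circle R) (p : circle R)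
    (e : R) : continuous T -> 0 < e ->
  exists2 d, 0 < d & forall x, mdist p x < d -> mdist (T p) (T x) < e.
Proof.
move=> cT e0; have /metricType_numDomainType.cvgrPdist_lt/(_ _ e0) := cT p.
by move=> /nbhs_ballP[d d0 dT]; exists d.
Qed.

Section invariant_finite_set.
Context (R : realType) (T : circle R -> circle R) (P : set (circle R)).
Context (theta : R) (cT : continuous T) (th : 0 < theta < 1).
Hypothesis expT : forall p : circle R,
  \forall x \near p, mdist p x <= theta * mdist (T p) (T x).
Hypotheses (fP : finite_set P) (TP : forall p, P p -> P (T p)).

(** If [q] is not [T p], continuity keeps [T x] closer to [T p] than half its distance from [q],
    hence away from [q]; finitely many pairs allow one radius. An orbit that stays near [P] must
    then pass from near [p] to near [T p]. *)
Lemma isolating_radius : exists2 d0 : R, 0 < d0 & forall p q x, P p -> P q ->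
  mdist p x < d0 -> mdist p x <= theta * mdist (T p) (T x) /\
                    (mdist q (T x) < d0 -> q = T p).
Proof.
have [d d0 dP] := @finite_set_common_radius R _ P (fun p d => forall x,
  mdist p x < d -> mdist p x <= theta * mdist (T p) (T x)) fP
  (fun p d d' d'0 d'd h x xd' => h x (lt_le_trans xd' d'd))
  (fun p Pp => let: ex_intro2 d d0 h := iffLR (nbhs_ballP _ _) (expT p) in
     ex_intro2 _ _ d d0 h).
have [p e e' e0 ee' h x q|p Pp|e e0 eP] := @finite_set_common_radius R _ P
    (fun p e => forall x q, P q -> mdist p x < e -> mdist q (T x) < e ->
       q = T p) fP.
- by move=> Pq pe qe; exact: h Pq (lt_le_trans pe ee') (lt_le_trans qe ee').
- have [q e e' e0 ee' h x|q Pq|e e0 eP] := @finite_set_common_radius R _ P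
    (fun q e => forall x, mdist p x < e -> mdist q (T x) < e -> q = T p) fP.
  + by move=> pe qe; exact: h (lt_le_trans pe ee') (lt_le_trans qe ee').
  + have [->|qTp] := eqVneq q (T p); first by exists 1.
    have eta0 : 0 < mdist q (T p) / 2 by rewrite divr_gt0// mdist_gt0.
    have [e e0 he] := @continuous_mdist _ _ p _ cT eta0.
    exists (Num.min e (mdist q (T p) / 2)); first by rewrite lt_min e0.
    move=> x; rewrite !lt_min => /andP[pe _] /andP[_ qx].
    have := he x pe; have := @metric_triangle R (circle R) q (T x) (T p).
    rewrite (metric_sym (T x)) => tri h.
    by move: (le_lt_trans tri (ltrD qx h)); rewrite -splitr ltxx.
  + by exists e => // x q Pq; exact: eP.
exists (Num.min d e); first by rewrite lt_min d0.
move=> p q x Pp Pq; rewrite !lt_min => /andP[pd pe]; split; first exact: dP.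
by move=> /andP[_ qe]; exact: (eP p Pp x).
Qed.

(** A forward induction shows that the orbit of [x] follows the orbit of one and the same [p]. A
    backward induction from time [m] then gains a factor [theta] at each step, by local
    expansion. *)
Lemma shadowing : exists2 d0 : R, 0 < d0 & forall d x m, d <= d0 ->
  (forall k, (k <= m)%N -> ball_around P d (iter k T x)) ->
  exists2 p, P p & forall k, (k <= m)%N ->
    mdist (iter k T p) (iter k T x) <= theta ^+ (m - k) * d.
Proof.
have [d0 d00 Hd0] := isolating_radius; exists d0 => // d x m dd0 near.
have [p Pp xp] := near 0%N isT; exists p => //.
have Pk k : P (iter k T p) by elim: k => //= k; exact: TP.
have close k : (k <= m)%N -> mdist (iter k T p) (iter k T x) < d.
  elim: k => // k IHk km; have {}IHk := IHk (ltnW km).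
  have [q Pq qx] := near k.+1 km.
  have [_ qE] := Hd0 _ _ _ (Pk k) Pq (lt_le_trans IHk dd0).
  by rewrite /= -qE//; exact: lt_le_trans qx dd0.
suff bound j : (j <= m)%N ->
    mdist (iter (m - j) T p) (iter (m - j) T x) <= theta ^+ j * d.
  by move=> k km; have := bound (m - k)%N (leq_subr _ _); rewrite subKn.
elim: j => [_|j IHj jm]; first by rewrite subn0 expr0 mul1r ltW// close.
case/andP: th => th0 _.
have E : (m - j)%N = (m - j.+1).+1 by lia.
have c := lt_le_trans (close (m - j.+1)%N (leq_subr _ _)) dd0.
have [exp _] := Hd0 _ _ _ (Pk _) (Pk 0%N) c.
apply: (le_trans exp); rewrite exprS -mulrA ler_pM2l//.
by have := IHj (ltnW jm); rewrite E.
Qed.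

Lemma trapped_in_finite_set : exists2 d0 : R, 0 < d0 & forall d x, d <= d0 ->
  (forall k, ball_around P d (iter k T x)) -> P x.
Proof.
have [d0 d00 Hd0] := shadowing; exists d0 => // d x dd0 near.
apply: contrapT => nPx.
(* [r] is a lower bound for the distance from [x] to all of [P]: the shadowing point used below
   depends on [m], so a bound for a single point would not do. *)
have [||r r0 rP] := @finite_set_common_radius R _ P (fun p r => r <= mdist p x) fP.
- by move=> p r r' _ r'r; exact: le_trans.
- move=> p Pp; exists (mdist p x) => //; rewrite mdist_gt0.
  by apply: contra_notN nPx => /eqP <-.
have d_gt0 : 0 < d.
  by have [p _ px] := near 0%N; apply: le_lt_trans px; exact: mdist_ge0.
case/andP: th => th0 th1.
have : theta ^+ m * d @[m --> \oo] --> 0 * d.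
  by apply: cvgMl; apply: cvg_expr; rewrite ger0_norm// ltW.
rewrite mul0r => /cvgrPdist_lt/(_ _ r0)[m _ /(_ m (leqnn m))/=].
rewrite sub0r normrN ger0_norm ?mulr_ge0 ?exprn_ge0 ?(ltW th0) ?(ltW d_gt0)//.
have [p Pp /(_ 0%N isT)] := Hd0 d x m dd0 (fun k _ => near k).
by rewrite subn0/= => /(le_trans (rP _ Pp)) /le_lt_trans/[apply]; rewrite ltxx.
Qed.

End invariant_finite_set.

(** * Visits to a set and iterated fibre maps *)

Lemma visitsS (R : realType) (T : circle R -> circle R) A n x :
  visits T A n.+1 x = (visits T A n x + (iter n T x \in A))%N.
Proof. by rewrite /visits big_ord_recr. Qed.

(** If [A] were avoided from time [n] on, the trapping hypothesis would put the [n]-th iterate in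
    [P]; so there is always a further visit. *)
Lemma visits_unbounded (R : realType) (T : circle R -> circle R)
    (P A : set (circle R)) :
  (forall x, (forall k, (~` A) (iter k T x)) -> P x) ->
  forall x, ~ eventually_in T P x ->
  forall K : nat, exists n, (K <= visits T A n x)%N.
Proof.
move=> trap x Px; elim=> [|K [n Kn]]; first by exists 0%N.
have [j Aj] : exists j, A (iter j T (iter n T x)).
  apply: contrapT => /forallNP h; apply: Px; exists n.
  by apply: trap => k; exact: h.
exists (j + n).+1; rewrite /visits big_ord_recr/= -iterD in Aj *.
rewrite mem_set// addn1 ltnS (leq_trans Kn)// /visits.
rewrite -!(big_mkord xpredT (fun i => nat_of_bool (iter i T x \in A))).
by rewrite [leqRHS](big_cat_nat (n := n))//= ?leq_addr// leq_addl.
Qed.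

Lemma least_period_iter (R : realType) (T : circle R -> circle R) x l i :
  least_period T x l -> (i < l)%N -> least_period T (iter i T x) l.
Proof.
move=> [l0 Tl minl] il; split=> //.
  by rewrite -iterD addnC iterD Tl.
move=> k kl E; apply: (minl k kl).
have Ek : iter (l - i) T (iter k T (iter i T x)) = iter k T x.
  by rewrite -!iterD (_ : (_ + _)%N = (k + l)%N) ?iterD ?Tl//; lia.
by rewrite -Ek E -iterD subnK ?(ltnW il).
Qed.

Lemma fibre_iter_invD (R : realType) (T : circle R -> circle R)
    (h : circle R -> R -> R) n m x t :
  fibre_iter_inv T h (n + m) x t =
  fibre_iter_inv T h n x (fibre_iter_inv T h m (iter n T x) t).
Proof.
elim: m t => [|m IHm] t; first by rewrite addn0.
by rewrite addnS /= IHm addnC iterD.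
Qed.

Lemma bounded_powers_of_periodic_fibres (R : realType)
    (T : circle R -> circle R) (h : circle R -> R -> R) p l :
  (0 < l)%N -> iter l T p = p -> (forall t, fibre_iter_inv T h l p t = t) ->
  exists K, forall n, `|fibre_iter_inv T h n p 0| <= K.
Proof.
move=> l0 Tp hp.
(* A crude bound for the maximum over one period; [n] is reduced modulo [l]. *)
exists (\sum_(r < l) `|fibre_iter_inv T h r p 0|) => n.
have -> : fibre_iter_inv T h n p 0 = fibre_iter_inv T h (n %% l) p 0.
  rewrite {1}(divn_eq n l); elim: (n %/ l)%N => [|q IHq]; first by rewrite mul0n.
  by rewrite mulSn -addnA fibre_iter_invD hp Tp.
rewrite (bigD1 (Ordinal (ltn_pmod n l0)))//= lerDl.
by apply: sumr_ge0 => i _; exact: normr_ge0.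
Qed.

Lemma bounded_on_itv (R : realType) (C : R -> R) (K : R) :
  bounded_on_compacts C -> exists2 M : R, 0 <= M & forall t, `|t| <= K -> C t <= M.
Proof.
move=> /(_ _ (@segment_compact _ (- K) K))[M0 [_ hM]].
(* [bounded] yields the bound only for constants strictly above [M0]. *)
exists (`|M0| + 1) => [|t tK]; first by rewrite addr_ge0.
apply: le_trans (ler_norm _) _; apply: (hM (`|M0| + 1)).
  by rewrite (le_lt_trans (ler_norm _))// ltrDl.
by rewrite /= in_itv/= -ler_norml.
Qed.

(** * Uniform bounds for the pull-backs of 0 *)

Section fibre_bounds.
Context (R : realType) (T : circle R -> circle R) (h : circle R -> R -> R).
Context (CS alpha theta : R).
Hypotheses (CS1 : 1 <= CS) (alpha0 : 0 < alpha) (th : 0 < theta < 1).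
Hypothesis h_lip : forall x n t t',
  `|fibre_iter_inv T h n x t - fibre_iter_inv T h n x t'| <= CS * `|t - t'|.
Variable Ch : R -> R.
Hypothesis Ch_bounded : bounded_on_compacts Ch.
Hypothesis h_holder : forall x y t,
  `|h x t - h y t| <= Ch t * mdist x y `^ alpha.

(** The orbit of [p] is replaced by that of [y] one time at a time. Each replacement costs a Hoelder
    error of the fibre maps, carried back with factor [CS]; these errors form a geometric series of
    ratio [theta] to the power [alpha], so [M] depends neither on [m] nor on the points. *)
Lemma shadowed_fibre_bound (K d : R) : 0 < d -> exists M, forall m p y,
  (forall k n, `|fibre_iter_inv T h n (iter k T p) 0| <= K) ->
  (forall k, (k < m)%N ->
     mdist (iter k T p) (iter k T y) <= theta ^+ (m.-1 - k) * d) ->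
  `|fibre_iter_inv T h m y 0| <= M.
Proof.
move=> d0; have [C C0 hC] := bounded_on_itv K Ch_bounded.
case/andP: th => th0 th1.
set q := theta `^ alpha.
have q1 : q < 1.
  have <- : 1 `^ alpha = 1 :> R by rewrite powR1.
  by rewrite gt0_ltr_powR ?nnegrE ?ler01// ltW.
have CS0 : 0 <= CS by exact: le_trans CS1.
pose c := CS * (C * d `^ alpha).
have c0 : 0 <= c by rewrite !mulr_ge0// powR_ge0.
exists (K + c / (1 - q)) => m p y pK near.
(* [a] interpolates between the pull-backs along the orbits of [p] and [y]. *)
pose a k := fibre_iter_inv T h k y (fibre_iter_inv T h (m - k) (iter k T p) 0).
(* The sum starts at the last time, where the shadowing error is largest. *)
suff H j : (j <= m)%N -> `|a m - a (m - j)%N| <= c * ((1 - q ^+ j) / (1 - q)).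
  have := H m (leqnn _); rewrite subnn {2}/a subn0 {1}/a subnn/= => {}H.
  rewrite -[X in `|X|](subrK (fibre_iter_inv T h m p 0)) addrC.
  apply: le_trans (ler_normD _ _) _; apply: lerD; first exact: (pK 0%N).
  apply: le_trans H _; rewrite ler_wpM2l// ler_pdivrMr ?subr_gt0//.
  by rewrite mulVf ?gt_eqF ?subr_gt0// lerBlDr lerDl exprn_ge0// powR_ge0.
elim: j => [_|j IHj jm]; first by rewrite subn0 subrr normr0 expr0 subrr mul0r mulr0.
have {}IHj := IHj (ltnW jm).
have -> : c * ((1 - q ^+ j.+1) / (1 - q)) =
    c * ((1 - q ^+ j) / (1 - q)) + c * q ^+ j.
  by rewrite exprS; field; rewrite subr_eq0 gt_eqF.
rewrite -[a m](subrK (a (m - j)%N)) -addrA.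
apply: le_trans (ler_normD _ _) _; apply: lerD => //.
have E : (m - j)%N = (m - j.+1).+1 by lia.
rewrite /a E; set k := (m - j.+1)%N.
have -> : (m - k = 1 + (m - k.+1))%N by rewrite /k; lia.
rewrite (@fibre_iter_invD _ T h 1) -[k.+1]addn1 (@fibre_iter_invD _ T h k 1)/=.
rewrite addn1.
set s := fibre_iter_inv T h (m - k.+1) (T (iter k T p)) 0.
apply: (le_trans (h_lip _ _ _ _)); rewrite /c -mulrA ler_wpM2l//.
apply: (le_trans (h_holder _ _ _)).
(* [s] is a pull-back over the orbit of [p], not of [y]: it is already known to be bounded by [K],
   which makes [C] available as Hoelder constant. *)
have sK : `|s| <= K by have := pK k.+1 (m - k.+1)%N.
apply: (@le_trans _ _ (C * mdist (iter k T y) (iter k T p) `^ alpha)).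
  by rewrite ler_wpM2r ?powR_ge0// hC.
rewrite -mulrA ler_wpM2l//.
have -> : d `^ alpha * q ^+ j = (theta ^+ j * d) `^ alpha.
  rewrite powRM ?exprn_ge0 ?(ltW th0) ?(ltW d0)// mulrC; congr (_ * _).
  by rewrite /q -!powR_mulrn ?powR_ge0 ?ltW// -!powRrM mulrC.
apply: ge0_ler_powR; rewrite ?nnegrE ?mulr_ge0 ?mdist_ge0 ?exprn_ge0
  ?(ltW alpha0) ?(ltW th0) ?(ltW d0)//.
rewrite metric_sym; have km : (k < m)%N by rewrite /k; lia.
by have := near k km; have -> : (m.-1 - k = j)%N by rewrite /k; lia.
Qed.

(** Segments avoiding [A] are bounded by [M]. A visit followed by such a segment moves 0 by at most
    [K + CS * M], and the earlier visits contract this displacement by a power of [lam]; the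
    displacements sum to a geometric series. *)
Lemma uniform_fibre_bound (A : set (circle R)) (lam K M : R) :
  0 < lam < 1 ->
  (forall x n t t',
     `|fibre_iter_inv T h n x t - fibre_iter_inv T h n x t'|
       <= CS * lam ^+ visits T A n x * `|t - t'|) ->
  (forall x, `|h x 0| <= K) ->
  (forall y m, (forall k, (k < m)%N -> ~ A (iter k T y)) ->
     `|fibre_iter_inv T h m y 0| <= M) ->
  exists M', forall x n, `|fibre_iter_inv T h n x 0| <= M'.
Proof.
move=> /andP[lam0 lam1] hvis hK away.
have CS0 : 0 <= CS by exact: le_trans CS1.
have M0 : 0 <= M by apply: le_trans (away (to_circle 0) 0%N _).
have K0 : 0 <= K by exact: le_trans (hK (to_circle 0)).
pose c := CS * (K + CS * M).
have c0 : 0 <= c by rewrite /c mulr_ge0// addr_ge0// mulr_ge0.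
(* The extra segment of [k] steps avoiding [A] makes the induction on [n] work:
   its contribution is at most [M], whatever [k] is. *)
have H x n : forall k, (forall i, (i < k)%N -> ~ A (iter (n + i) T x)) ->
    `|fibre_iter_inv T h (n + k) x 0| <=
      M + c * ((1 - lam ^+ visits T A n x) / (1 - lam)).
  elim: n => [|n IHn] k near.
    by rewrite /visits big_ord0 expr0 subrr mul0r mulr0 addr0; exact: away.
  rewrite visitsS.
  (* A step outside [A] joins the avoiding segment and leaves the number of visits unchanged. *)
  have [An|An] := pselect (A (iter n T x)); last first.
    rewrite memNset// addn0 addSnnS; apply: IHn => -[|i] ik; first by rewrite addn0.
    by rewrite addnS -addSn; exact: near.
  rewrite mem_set// addn1.
  have -> : M + c * ((1 - lam ^+ (visits T A n x).+1) / (1 - lam)) =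
      M + c * ((1 - lam ^+ visits T A n x) / (1 - lam)) + c * lam ^+ visits T A n x.
    by rewrite exprS; field; rewrite subr_eq0 gt_eqF.
  rewrite addSnnS fibre_iter_invD.
  set s := fibre_iter_inv T h k.+1 _ _.
  rewrite -(subrK (fibre_iter_inv T h n x 0) (fibre_iter_inv T h n x s)) addrC.
  apply: le_trans (ler_normD _ _) _; apply: lerD.
    by have := IHn 0%N; rewrite addn0; apply.
  apply: (le_trans (hvis _ _ _ _)); rewrite subr0.
  rewrite /c -!mulrA ler_wpM2l// mulrC ler_wpM2r ?exprn_ge0 ?(ltW lam0)//.
  rewrite /s -[k.+1]add1n (@fibre_iter_invD _ T h 1)/=.
  set y := iter n T x; set w := fibre_iter_inv T h k _ _.
  rewrite -(subrK (h y 0) (h y w)) addrC.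
  apply: le_trans (ler_normD _ _) _; apply: lerD => //.
  apply: (le_trans (h_lip y 1 w 0)); rewrite subr0 ler_wpM2l//.
  by apply: away => i ik; have := near i ik; rewrite addnC iterD.
exists (M + c / (1 - lam)) => x n.
have := H x n 0%N; rewrite addn0 => /(_ _)/le_trans; apply => //.
rewrite lerD2l ler_wpM2l// ler_pdivrMr ?subr_gt0//.
by rewrite mulVf ?gt_eqF ?subr_gt0// lerBlDr lerDl exprn_ge0// ltW.
Qed.

End fibre_bounds.

(** * The invariant graph as a pull-back limit *)

Lemma visits_monotone (R : realType) (T : circle R -> circle R) A x n m :
  (n <= m)%N -> (visits T A n x <= visits T A m x)%N.
Proof.
elim: m => [|m IHm]; first by rewrite leqn0 => /eqP->.
rewrite leq_eqVlt => /orP[/eqP->//|nm].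
by rewrite visitsS (leq_trans (IHm nm))// leq_addr.
Qed.

Lemma eventually_inT (R : realType) (T : circle R -> circle R) P n x :
  eventually_in T P (iter n T x) -> eventually_in T P x.
Proof. by move=> [k Pk]; exists (k + n)%N; rewrite iterD. Qed.

Section invariant_graph.
Context (R : realType) (T : circle R -> circle R) (P A : set (circle R)).
Context (g h : circle R -> R -> R) (CS lam M : R).
Hypotheses (gh : fibre_homeomorphisms g h) (CS0 : 0 <= CS) (lam01 : 0 < lam < 1).
Hypothesis h_contr : forall x n t t',
  `|fibre_iter_inv T h n x t - fibre_iter_inv T h n x t'|
    <= CS * lam ^+ visits T A n x * `|t - t'|.
Hypothesis h_bounded : forall x n, `|fibre_iter_inv T h n x 0| <= M.
Hypothesis many_visits : forall x, ~ eventually_in T P x ->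
  forall K : nat, exists n, (K <= visits T A n x)%N.

(** [lim] takes a default value where the sequence diverges; convergence is established outside
    [eventually_in T P]. *)
Definition invariant_graph x : R := lim (fibre_iter_inv T h n x 0 @[n --> \oo]).

Lemma contraction_small x C e : ~ eventually_in T P x -> 0 <= C -> 0 < e ->
  exists n, forall m, (n <= m)%N -> CS * lam ^+ visits T A m x * C < e.
Proof.
move=> Px C0 e0; case/andP: lam01 => lam0 lam1.
have : CS * lam ^+ m * C @[m --> \oo] --> CS * 0 * C.
  by apply: cvgMl; apply: cvgMr; apply: cvg_expr; rewrite ger0_norm// ltW.
rewrite mulr0 mul0r => /cvgrPdist_lt/(_ _ e0)[K _ /(_ K (leqnn K))/=].
have pos k : 0 <= CS * lam ^+ k * C by rewrite !mulr_ge0// exprn_ge0// ltW.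
rewrite sub0r normrN ger0_norm// => small.
have [n Kn] := many_visits Px K; exists n => m nm; apply: le_lt_trans small.
rewrite ler_wpM2r// ler_wpM2l// ler_wiXn2l// ?ltW//.
exact: leq_trans (visits_monotone _ _ _ nm).
Qed.

(** Two late terms are the images under the same n-th pull-back of 0 and of a point bounded by [M],
    so their distance is controlled by the visits up to time [n]: the sequence is Cauchy. *)
Lemma invariant_graph_cvg x : ~ eventually_in T P x ->
  fibre_iter_inv T h n x 0 @[n --> \oo] --> invariant_graph x.
Proof.
move=> Px; apply: cauchy_cvg; apply: cauchy_exP => e e0.
have M0 : 0 <= M by exact: le_trans (h_bounded x 0).
have [n small] := contraction_small Px M0 e0.
exists (fibre_iter_inv T h n x 0); exists n => // m /= nm.
rewrite -(subnKC nm) fibre_iter_invD /ball/=.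
apply: le_lt_trans (small n (leqnn n)); apply: le_trans (h_contr _ _ _ _) _.
rewrite sub0r normrN ler_wpM2l//.
by rewrite mulr_ge0// exprn_ge0// ltW//; case/andP: lam01.
Qed.

Lemma invariant_graph_bounded x : ~ eventually_in T P x ->
  `|invariant_graph x| <= M.
Proof.
move=> Px; have hn : `|fibre_iter_inv T h n x 0| @[n --> \oo] -->
    `|invariant_graph x| by apply: cvg_norm; exact: invariant_graph_cvg.
rewrite -(cvg_lim (@Rhausdorff _) hn); apply: limr_le; first exact: cvgP hn.
exact: nearW.
Qed.

(** The limit is taken in the splitting of the first step from the remaining ones, using continuity
    of [h x]; applying [g x] then reverses the direction. *)
Lemma invariant_graph_equivariant x : ~ eventually_in T P x ->
  invariant_graph (T x) = g x (invariant_graph x).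
Proof.
move=> Px; have PTx : ~ eventually_in T P (T x).
  by move/(@eventually_inT _ _ _ 1).
have [gK hK _ hc] := gh x.
suff -> : invariant_graph x = h x (invariant_graph (T x)) by rewrite hK.
have h1 : fibre_iter_inv T h n.+1 x 0 @[n --> \oo] --> invariant_graph x.
  by rewrite (cvg_shiftS (fun n => fibre_iter_inv T h n x 0)); exact: invariant_graph_cvg.
have h2 : h x (fibre_iter_inv T h n (T x) 0) @[n --> \oo] -->
    h x (invariant_graph (T x)).
  by apply: continuous_cvg; [exact: hc|exact: invariant_graph_cvg].
apply: cvg_unique h1 _ => //.
have -> // : (fun n => fibre_iter_inv T h n.+1 x 0) =
             (fun n => h x (fibre_iter_inv T h n (T x) 0)).
by apply/funext => n; rewrite -add1n fibre_iter_invD.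
Qed.

Lemma pull_back_orbit (v : circle R -> R) x n :
  (forall k, v (iter k.+1 T x) = g (iter k T x) (v (iter k T x))) ->
  v x = fibre_iter_inv T h n x (v (iter n T x)).
Proof.
move=> vx; elim: n => //= n IHn; rewrite -iterS vx.
by have [gK _ _ _] := gh (iter n T x); rewrite gK.
Qed.

(** Both functions at [x] are pull-backs of their values at time [k]. At late times with [v] bounded
    by [K] these values differ by at most [K + M], and the contraction makes the difference at [x]
    arbitrarily small. Boundedness at infinitely many times is what recurrence provides for a
    measurable [v]. *)
Lemma invariant_graph_unique (v : circle R -> R) x K :
  ~ eventually_in T P x ->
  (forall k, v (iter k.+1 T x) = g (iter k T x) (v (iter k T x))) ->
  (forall n, exists2 k, (n <= k)%N & `|v (iter k T x)| <= K) ->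
  v x = invariant_graph x.
Proof.
move=> Px vx recur.
have Pn n : ~ eventually_in T P (iter n T x) by move/eventually_inT.
have M0 : 0 <= M by exact: le_trans (h_bounded x 0).
have K0 : 0 <= K by have [k _] := recur 0%N; exact: le_trans.
apply/eqP; rewrite -subr_eq0 -normr_le0; apply/ler_addgt0Pr => e e0; rewrite add0r.
have [n small] := contraction_small Px (addr_ge0 K0 M0) e0.
have [k nk vk] := recur n; apply: le_trans (ltW (small k nk)).
rewrite (pull_back_orbit k vx) [invariant_graph x](@pull_back_orbit _ _ k); last first.
  by move=> i; rewrite iterS invariant_graph_equivariant.
apply: le_trans (h_contr _ _ _ _) _; apply: ler_wpM2l.
  by rewrite mulr_ge0// exprn_ge0// ltW//; case/andP: lam01.
by apply: le_trans (ler_normB _ _) _; rewrite lerD// invariant_graph_bounded.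
Qed.

End invariant_graph.

(** * Continuity of the pull-backs in the base point *)

Section fibre_continuity.
Context (R : realType) (T : circle R -> circle R) (h : circle R -> R -> R).
Context (CS alpha : R) (Ch : R -> R).
Hypotheses (cT : continuous T) (alpha0 : 0 < alpha) (CS0 : 0 <= CS).
Hypothesis h_lip : forall x t t', `|h x t - h x t'| <= CS * `|t - t'|.
Hypothesis h_holder : forall x y t,
  `|h x t - h y t| <= Ch t * mdist x y `^ alpha.

Lemma continuous_fibre_comp (f : circle R -> circle R) (t : circle R -> R) :
  continuous f -> continuous t -> continuous (fun x => h (f x) (t x)).
Proof.
move=> cf ct x; apply/(@cvgrPdist_lt _ _ _ (nbhs x) (nbhs_filter x)) => e e0.
pose C := `|Ch (t x)| + 1.
have C0 : 0 < C by rewrite ltr_wpDl.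
(* Chosen so that [C] times the power [alpha] of [d] equals [e / 2]. *)
pose d := (e / 2 / C) `^ alpha^-1.
have e2 : 0 < e / 2 / C by rewrite !divr_gt0.
have d0 : 0 < d by rewrite powR_gt0.
have h1 : \forall y \near x, mdist (f x) (f y) < d.
  have [d1 d10 hd] := @continuous_mdist _ _ x _ cf d0.
  by apply/nbhs_ballP; exists d1 => // y; exact: hd.
have h2 : \forall y \near x, `|t x - t y| < e / 2 / (CS + 1).
  have /(@cvgrPdist_lt _ _ _ (nbhs x) (nbhs_filter x)) H := ct x.
  by apply: H; rewrite !divr_gt0// ltr_wpDl.
near=> y.
have H1 : mdist (f x) (f y) < d by near: y.
have H2 : `|t x - t y| < e / 2 / (CS + 1) by near: y.
rewrite -(subrK (h (f y) (t x)) (h (f x) (t x))) -addrA.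
apply: le_lt_trans (ler_normD _ _) _; rewrite [e]splitr ltr_leD//.
  apply: le_lt_trans (h_holder _ _ _) _.
  apply: (@le_lt_trans _ _ (C * mdist (f x) (f y) `^ alpha)).
    rewrite ler_wpM2r ?powR_ge0//.
    by rewrite (le_trans (ler_norm _))// lerDl.
  rewrite mulrC -ltr_pdivlMr//.
  have <- : d `^ alpha = e / 2 / C.
    by rewrite /d -powRrM mulVf ?gt_eqF// powRr1// ltW.
  by rewrite gt0_ltr_powR// nnegrE ?mdist_ge0// ltW.
apply: le_trans (h_lip _ _ _) _.
apply: (@le_trans _ _ ((CS + 1) * `|t x - t y|)).
  by rewrite ler_wpM2r// lerDl.
by rewrite mulrC -ler_pdivlMr ?ltr_wpDl// ltW.
Unshelve. all: by end_near. Qed.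

Lemma continuous_iter n : continuous (iter n T).
Proof.
elim: n => [|n IHn] x; first exact: cvg_id.
by apply: (@continuous_comp _ _ _ (iter n T) T); [exact: IHn|exact: cT].
Qed.

(** The height [t] varies with [x] because the recursion replaces a constant height by one that
    depends on the base point. *)
Lemma continuous_fibre_iter_inv n (t : circle R -> R) : continuous t ->
  continuous (fun x => fibre_iter_inv T h n x (t x)).
Proof.
elim: n t => [//|n IHn] t ct /=.
by apply: IHn; apply: continuous_fibre_comp => //; exact: continuous_iter.
Qed.

End fibre_continuity.

(** * Measure-preserving maps and recurrence *)

Lemma measurable_iter (dX : measure_display) (X : measurableType dX) (T : X -> X) n :
  measurable_fun setT T -> measurable_fun setT (iter n T).
Proof.
move=> mT; elim: n => [|n IHn]; first exact: measurable_id.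
exact: measurableT_comp.
Qed.

Section invariant_measures.
Context (dX : measure_display) (X : measurableType dX) (R : realType).
Context (mu : probability X R) (T : X -> X).
Hypothesis mT : measurable_fun setT T.
Hypothesis muT : forall B : set X, measurable B -> mu (T @^-1` B) = mu B.

Lemma measurable_preimage_iter n (B : set X) :
  measurable B -> measurable (iter n T @^-1` B).
Proof.
by move=> mB; rewrite -[X in measurable X]setTI; exact: measurable_iter.
Qed.

Lemma invariant_measure_iter n (B : set X) :
  measurable B -> mu (iter n T @^-1` B) = mu B.
Proof.
move=> mB; elim: n => // n <-; rewrite -[RHS]muT; last exact: measurable_preimage_iter.
by congr (mu _); apply/seteqP; split=> x /=; rewrite -iterSr.
Qed.

Lemma negligible_preimage_iter n (B : set X) :
  mu.-negligible B -> mu.-negligible (iter n T @^-1` B).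
Proof.
move=> [C [mC C0 BC]]; exists (iter n T @^-1` C); split.
- exact: measurable_preimage_iter.
- by rewrite -C0; exact: invariant_measure_iter.
- by move=> x; exact: BC.
Qed.

(** Let [A n] be the points that meet [E] at some time at least [n]. These sets decrease, and each
    is the preimage of the previous one, so all have the same finite measure; hence [A 0] without
    [A n] is null, and [E] lies in [A 0]. *)
Lemma poincare_recurrence (E : set X) : measurable E ->
  mu.-negligible (E `\`
    \bigcap_n \bigcup_(k in [set k | (n <= k)%N]) (iter k T @^-1` E)).
Proof.
move=> mE; pose A n := \bigcup_(k in [set k | (n <= k)%N]) (iter k T @^-1` E).
have mA n : measurable (A n).
  by apply: bigcup_measurable => k _; exact: measurable_preimage_iter.
have AS n : A n.+1 = T @^-1` (A n).
  apply/seteqP; split=> [x [[//|k] /= nk Ek]|x [k /= nk Ek]].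
    by exists k => //=; rewrite -iterSr.
  by exists k.+1 => //; rewrite /preimage/= -iterS iterSr.
have muA n : mu (A n) = mu (A 0%N) by elim: n => // n <-; rewrite AS muT.
apply: (@negligibleS _ _ _ _ (\bigcup_n (A 0%N `\` A n))).
  move=> x [Ex /existsNP[n /not_implyP[_ nA]]]; exists n => //.
  by split=> //; exists 0%N.
apply: negligible_bigcup => n; apply/negligibleP; first exact: measurableD.
rewrite measureD// ?(le_lt_trans (probability_le1 mu (mA 0%N))) ?ltry//.
rewrite (_ : A 0%N `&` A n = A n); last first.
  by apply/setIidPr => x [k nk Ek]; exists k.
rewrite [X in (_ - X)%E](_ : _ = mu (A 0%N)); last exact: muA.
by apply: subee; exact: fin_num_measure.
Qed.

End invariant_measures.

(** * Measurability on the circle *)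

Lemma open_measurable_circle (R : realType) (U : set (circle R)) :
  open U -> measurable U.
Proof. by move=> oU; exact: sub_sigma_algebra. Qed.

Lemma continuous_measurable_circle (R : realType) (T : circle R -> circle R) :
  continuous T -> measurable_fun setT T.
Proof.
move=> /continuousP cT; apply: (@measurability _ _ _ _ _ _ (@open (circle R))) => //.
by move=> _ [U oU <-]; rewrite setTI; apply: open_measurable_circle; exact: cT.
Qed.

Lemma continuous_measurable_circle_fun (R : realType) (f : circle R -> R) :
  continuous f -> measurable_fun setT f.
Proof.
move=> /continuousP cf; apply: (measurability _ (RGenOpens.measurableE R)).
move=> _ [_ [a [b ->]] <-]; rewrite setTI.
by apply: open_measurable_circle; apply: cf; exact: interval_open.
Qed.

Lemma measurable_eventually_in (R : realType) (T : circle R -> circle R) P :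
  continuous T -> finite_set P -> measurable (eventually_in T P).
Proof.
move=> cT fP; have -> : eventually_in T P = \bigcup_n (iter n T @^-1` P).
  by apply/seteqP; split=> x [n] //; [exists n|move=> _; exists n].
apply: bigcupT_measurable => n; apply: measurable_preimage_iter.
  exact: continuous_measurable_circle.
rewrite -[P]setCK; apply: measurableC; apply: open_measurable_circle.
by apply: closed_openC; exact: finite_set_closed_circle.
Qed.

(** * Contraction and boundedness for the class of skew products *)

Lemma periodic_orbits_union (R : realType) (T : circle R -> circle R) rho
    (Porb : 'I_rho -> set (circle R)) : (forall r, periodic_orbit T (Porb r)) ->
  [/\ finite_set (\bigcup_r Porb r),
      forall p, (\bigcup_r Porb r) p -> (\bigcup_r Porb r) (T p)
    & forall p, (\bigcup_r Porb r) p -> exists l, least_period T p l].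
Proof.
move=> orb; split=> [|p [r _ pr]|p [r _ pr]].
- apply: bigcup_finite => [|r _]; first exact: finite_finset.
  by have [x [l [_ ->]]] := orb r; apply: finite_image; exact: finite_II.
- exists r => //; move: pr; have [x [l [[l0 Tl _] ->]]] := orb r.
  case=> i /= il <-; have [il1|li] := ltnP i.+1 l; first by exists i.+1.
  by exists 0%N => //=; rewrite -iterS (_ : i.+1 = l) ?Tl//; lia.
- move: pr; have [x [l [xl ->]]] := orb r; case=> i /= il <-.
  by exists l; exact: least_period_iter.
Qed.

Lemma mdist_circle_le1 (R : realType) (x y : circle R) : mdist x y <= 1.
Proof.
have /andP[x0 x1] := circle_val_itv x; have /andP[y0 y1] := circle_val_itv y.
rewrite /mdist/= /circle_dist ge_min; apply/orP; left.
by rewrite ler_norml; apply/andP; split; lra.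
Qed.

(** Collects what the construction of the graph requires, with [A] the complement of a small
    neighbourhood of [P]. *)
Lemma skew_class_contraction (R : realType) (T : circle R -> circle R)
    (P : set (circle R)) (alpha CS : R) (g h : circle R -> R -> R) :
  expanding_markov_map T -> finite_set P -> (forall p, P p -> P (T p)) ->
  (forall p, P p -> exists l, least_period T p l) ->
  0 < alpha -> 1 <= CS -> fibre_homeomorphisms g h -> skew_class T P alpha CS g h ->
  exists (A : set (circle R)) (lam M : R),
    [/\ 0 < lam < 1,
        forall x n t t', `|fibre_iter_inv T h n x t - fibre_iter_inv T h n x t'|
          <= CS * lam ^+ visits T A n x * `|t - t'|,
        forall x n, `|fibre_iter_inv T h n x 0| <= M
      & forall x, ~ eventually_in T P x ->
          forall K : nat, exists n, (K <= visits T A n x)%N].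
Proof.
move=> hT fP TP perP alpha0 CS1 gh [eps eps0].
move=> [per h_lip _ h_vis [Cg [Ch [_ Ch_bd hol]]]].
have cT := hT.1.
have [theta th expT] := markov_local_expansion hT.
have [d1 d10 shadow] := shadowing cT th expT fP TP.
have [d2 d20 trapped] := trapped_in_finite_set cT th expT fP TP.
(* Small enough for the contraction in the class, for shadowing and for trapping. *)
pose d := Num.min eps (Num.min d1 d2).
have d0 : 0 < d by rewrite !lt_min eps0 d10.
have deps : d <= eps by rewrite ge_min lexx.
have dd1 : d <= d1 by rewrite /d !ge_min lexx !orbT.
have dd2 : d <= d2 by rewrite /d !ge_min lexx !orbT.
have [|lam lam01 h_contr] := h_vis d; first by rewrite d0.
have h_holder x y t : `|h x t - h y t| <= Ch t * mdist x y `^ alpha.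
  by case: (hol x y t).
have Pk p k : P p -> P (iter k T p) by move=> Pp; elim: k => //= k; exact: TP.
(* A common upper bound over [P] is obtained as the inverse of a common radius. *)
have [||k0 k00 hk0] := @finite_set_common_radius R _ P
    (fun p r => forall n, `|fibre_iter_inv T h n p 0| <= r^-1) fP.
- move=> p r r' r'0 r'r hr n; apply: le_trans (hr n) _.
  by rewrite lef_pV2 ?posrE// (lt_le_trans r'0).
- move=> p Pp; have [l pl] := perP p Pp; have [l0 Tl _] := pl.
  have [|K hK] := @bounded_powers_of_periodic_fibres R T h p l l0 Tl.
    move=> t; have [gK _] := fibre_iterK T l p gh.
    by rewrite -{1}(per p l t Pp pl).
  have K0 : 0 <= K by exact: le_trans (hK 0%N).
  exists (K + 1)^-1; first by rewrite invr_gt0 ltr_wpDl.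
  by move=> n; rewrite invrK (le_trans (hK n))// lerDl.
have [M1 hM1] := shadowed_fibre_bound CS1 alpha0 th h_lip Ch_bd h_holder k0^-1 d0.
have away y m : (forall k, (k < m)%N -> ~ (~` ball_around P d) (iter k T y)) ->
    `|fibre_iter_inv T h m y 0| <= `|M1|.
  (* A pull-back over [m.+1] steps involves the times 0 to [m], the range covered by [shadow]; with
     no step the value is 0. *)
  case: m => [_|m near]; first by rewrite normr0.
  apply: le_trans (ler_norm _).
  have [|p Pp sh] := shadow d y m dd1.
    by move=> k km; apply: contrapT; exact: near.
  apply: (hM1 _ p) => [k n|k km]; first exact/hk0/Pk.
  exact: sh.
(* The circle has diameter at most 1, so the Hoelder bound at height 0 compares every fibre with the
   one over [to_circle 0]. *)
have hK x : `|h x 0| <= `|h (to_circle 0) 0| + `|Ch 0|.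
  rewrite -(subrK (h (to_circle 0) 0) (h x 0)) addrC.
  apply: le_trans (ler_normD _ _) _; rewrite lerD2l.
  apply: le_trans (h_holder _ _ _) _.
  apply: (@le_trans _ _ (`|Ch 0| * mdist x (to_circle 0) `^ alpha)).
    by rewrite ler_wpM2r ?powR_ge0// ler_norm.
  rewrite ler_piMr// -[leRHS](_ : 1 `^ alpha = 1); last by rewrite powR1.
  by apply: ge0_ler_powR; rewrite ?nnegrE ?mdist_ge0 ?mdist_circle_le1 ?(ltW alpha0).
have [M hM] := uniform_fibre_bound CS1 h_lip lam01 h_contr hK away.
exists (~` ball_around P d), lam, M; split=> //.
apply: visits_unbounded => x; rewrite setCK; exact: trapped.
Qed.

(** * Uniqueness almost everywhere for an ergodic measure *)

Section almost_everywhere_uniqueness.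
Context (R : realType) (T : circle R -> circle R) (P A : set (circle R)).
Context (g h : circle R -> R -> R) (CS lam M : R).
Hypotheses (gh : fibre_homeomorphisms g h) (CS0 : 0 <= CS) (lam01 : 0 < lam < 1).
Hypothesis h_contr : forall x n t t',
  `|fibre_iter_inv T h n x t - fibre_iter_inv T h n x t'|
    <= CS * lam ^+ visits T A n x * `|t - t'|.
Hypothesis h_bounded : forall x n, `|fibre_iter_inv T h n x 0| <= M.
Hypothesis many_visits : forall x, ~ eventually_in T P x ->
  forall K : nat, exists n, (K <= visits T A n x)%N.
Hypotheses (cT : continuous T) (fP : finite_set P).
Hypothesis (TP : forall p, P p -> P (T p)).
Context (mu : probability (circle R) R) (mu_erg : ergodic_measure T mu).
Hypothesis mu_P : mu (eventually_in T P) != 1%E.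

(** Forward invariance of [P] makes this set equal to its own preimage, so ergodicity leaves only
    the measures 0 and 1. *)
Lemma negligible_eventually_in : mu.-negligible (eventually_in T P).
Proof.
have mE := measurable_eventually_in cT fP.
apply/negligibleP => //; have [_ /(_ _ mE)[|//|E1]] := mu_erg.
  apply/seteqP; split=> x [n Pn]; first by exists n.+1; rewrite iterSr.
  by exists n; rewrite /= -iterSr; exact: TP.
by move: mu_P; rewrite E1 eqxx.
Qed.

(* Almost every point returns infinitely often to a set where [v] is bounded,
   so that [v] is as good as bounded along its orbit. *)
Lemma invariant_graph_ae_unique (v : circle R -> R) :
  measurable_fun (~` eventually_in T P) v ->
  {ae mu, forall x, v (T x) = g x (v x)} ->
  {ae mu, forall x, v x = invariant_graph T h x}.
Proof.
move=> mv aev; have mE := measurable_eventually_in cT fP.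
have mT := continuous_measurable_circle cT.
have muT := mu_erg.1.
(* As [K] grows these sets exhaust the domain on which [v] is measurable. *)
pose E K := ~` eventually_in T P `&` v @^-1` `[- K%:R, K%:R].
have mEK (K : nat) : measurable (E K).
  by apply: mv; [exact: measurableC|exact: measurable_itv].
(* Points whose orbit violates the equation at some time: a countable union of null sets, by
   invariance of [mu]. *)
pose bad := \bigcup_n (iter n T @^-1` ~` [set x | v (T x) = g x (v x)]).
pose transient := \bigcup_K (E K `\`
  \bigcap_n \bigcup_(k in [set k | (n <= k)%N]) (iter k T @^-1` E K)).
apply: (@negligibleS _ _ _ _ (eventually_in T P `|` bad `|` transient)); last first.
  apply: negligibleU; last by apply: negligible_bigcup => K; exact: poincare_recurrence.
  apply: negligibleU; first exact: negligible_eventually_in.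
  by apply: negligible_bigcup => n; exact: negligible_preimage_iter.
move=> x; apply: contra_notP => /not_orP[/not_orP[Px nbad] ntrans].
have [K vK] : exists K : nat, `|v x| <= K%:R.
  by exists (Num.bound `|v x|); apply: ltW; exact: archi_boundP.
apply: (invariant_graph_unique gh CS0 lam01 h_contr h_bounded many_visits
  (K := K%:R)) => // [k|n].
  by apply: contrapT => nv; apply: nbad; exists k.
have [k nk [_ /= vk]] : (\bigcup_(k in [set k | (n <= k)%N]) (iter k T @^-1` E K)) x.
  apply: contrapT => nr; apply: ntrans; exists K => //; split.
    by split=> //=; rewrite in_itv/= -ler_norml.
  by move=> /(_ n I).
by exists k => //; move: vk; rewrite in_itv/= -ler_norml.
Qed.

End almost_everywhere_uniqueness.

(** * Existence, uniqueness and measurability of the bounded graph *)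

Unset Implicit Arguments.
Theorem theorem1 (R : realType) (T : circle R -> circle R)
  (hT : expanding_markov_map T)
  (rho : nat) (Porb : 'I_rho -> set (circle R))
  (hPorb : forall r, periodic_orbit T (Porb r)) (Porb_inj : injective Porb)
  (P : set (circle R)) (hP : P = \bigcup_r Porb r)
  (alpha CS : R) (halpha : 0 < alpha) (hCS : 1 <= CS)
  (g h : circle R -> R -> R) (hgh : fibre_homeomorphisms g h)
  (hg : skew_class T P alpha CS g h) :
  exists u : circle R -> R,
    [/\ [bounded u x | x in ~` eventually_in T P],
        forall x, ~ eventually_in T P x -> u (T x) = g x (u x),
        forall v : circle R -> R,
          [bounded v x | x in ~` eventually_in T P] ->
          (forall x, ~ eventually_in T P x -> v (T x) = g x (v x)) ->
          forall x, ~ eventually_in T P x -> v x = u x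
      & forall mu : probability (circle R) R,
          ergodic_measure T mu -> mu (eventually_in T P) != 1%E ->
          measurable_fun (~` eventually_in T P) u /\
          forall v : circle R -> R,
            measurable_fun (~` eventually_in T P) v ->
            {ae mu, forall x, v (T x) = g x (v x)} ->
            {ae mu, forall x, v x = u x}].

Proof.
have [fP TP perP] := periodic_orbits_union hPorb; rewrite -hP in fP TP perP.
have cT := hT.1; have CS0 : 0 <= CS by exact: le_trans hCS.
have [A [lam [M [lam01 h_contr h_bd many]]]] :=
  skew_class_contraction hT fP TP perP halpha hCS hgh hg.
have [eps _ [_ h_lip _ _ [Cg [Ch [_ _ hol]]]]] := hg.
exists (invariant_graph T h); split.
- exists M; split; first exact: num_real.
  move=> M' MM' x Px; apply: le_trans (ltW MM').
  exact: (invariant_graph_bounded CS0 lam01 h_contr h_bd many Px).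
- move=> x Px; exact: (invariant_graph_equivariant hgh CS0 lam01 h_contr h_bd many Px).
- move=> v [K [_ vK]] veq x Px.
  have Pn n : ~ eventually_in T P (iter n T x) by move/eventually_inT.
  (* [K + 1] lies strictly above the bound in [bounded]; it bounds [v] at every time, so the time
     [n] itself serves as return time. *)
  apply: (invariant_graph_unique hgh CS0 lam01 h_contr h_bd many (K := K + 1)) => //.
    by move=> k; exact: veq (Pn k).
  by move=> n; exists n => //; apply: vK (Pn n); rewrite ltrDl.
move=> mu mu_erg mu_P; split; last first.
  move=> v mv aev; exact: (invariant_graph_ae_unique hgh CS0 lam01 h_contr h_bd
    many cT fP TP mu_erg mu_P mv aev).
(* The graph is a pointwise limit of functions continuous in the base point. *)
apply: (measurable_fun_cvg (h := fun n x => fibre_iter_inv T h n x 0)) => [n|x Px].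
  apply: measurable_funTS; apply: continuous_measurable_circle_fun.
  apply: (continuous_fibre_iter_inv (CS := CS) (alpha := alpha) (Ch := Ch)) => //.
  - by move=> x t t'; exact: (h_lip x 1%N).
  - by move=> x y t; case: (hol x y t).
  - exact: cst_continuous.
exact: (invariant_graph_cvg CS0 lam01 h_contr h_bd many Px).
Qed.
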